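(* Let $d\ge1$, let $P$ be a probability distribution on $[0,1]^d$ with lower-orthant distribution function $F_P(x)=P(\{s\in[0,1]^d:s_k\le x_k\text{ for all }k\})$, and let $F_0(x)=\prod_{k=0}^{d-1}x_k$ be the uniform distribution function. If $F_P\ne F_0$ on a subset of $[0,1]^d$ of positive Lebesgue measure, then under iid sampling $X_1,X_2,\dots\sim P$, $$n\,\bar\omega^2_d\xrightarrow{\ \mathbb P\ }\infty\quad\text{as }n\to\infty,$$ i.e. for every $M<\infty$, $\mathbb P(n\,\bar\omega^2_d>M)\to1$.
   Context: A corner of $[0,1]^d$ is a function $c:\{0,\dots,d-1\}\to\{\mathrm{true},\mathrm{false}\}$; there are $2^d$ corners. For a corner $c$ and $x\in[0,1]^d$, $\mathrm{cornerLe}(c,x)=\{s\in[0,1]^d:\ \text{for all }k,\ s_k\ge x_k\text{ if }c(k)=\mathrm{true},\ s_k\le x_k\text{ if }c(k)=\mathrm{false}\}$. Put $F_n^c(x)=\frac1n\sum_{i=1}^n\mathbf 1\{X_i\in\mathrm{cornerLe}(c,x)\}$ and $F^c(x)=\prod_{k=0}^{d-1}g_k(x)$ with $g_k(x)=1-x_k$ if $c(k)=\mathrm{true}$ and $g_k(x)=x_k$ otherwise. The statistic based on $X_1,\dots,X_n$ is $\bar\omega^2_d=\frac1{2^d}\sum_c\int_{[0,1]^d}(F_n^c(x)-F^c(x))^2\,dx$, the sum running over all corners. *)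

(* Defs.v *)
From HB Require Import structures.
From mathcomp Require Import all_boot all_order all_algebra.
From mathcomp Require Import finmap.
From mathcomp Require Import all_classical all_reals all_analysis.

Set Implicit Arguments.
Unset Strict Implicit.
Unset Printing Implicit Defensive.
Import Order.TTheory GRing.Theory Num.Theory.
Import numFieldNormedType.Exports.
Local Open Scope classical_set_scope.
Local Open Scope ring_scope.

(* [d.-tuple T] carries the sigma-algebra generated by the coordinate maps, so
   [pt R d] is R^d with its Borel sigma-algebra. *)
Notation pt R d := (d.-tuple (measurableTypeR R)).

Section lebesgue_measure_on_tuples.
Context (R : realType).

Definition tcons (d : nat) (p : pt R d * measurableTypeR R) : pt R d.+1 :=
  [the d.+1.-tuple (measurableTypeR R) of p.2 :: p.1].

Lemma measurable_tcons (d : nat) : measurable_fun setT (@tcons d).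
Proof. exact: measurable_cons. Qed.

(* The canonical measure structure of [pushforward] depends on the measurability
   proof, which unification cannot find, hence the explicit instance. *)
Definition pushforward_tcons (d : nat)
    (m : {measure set (pt R d * measurableTypeR R) -> \bar R}) :
    {measure set (pt R d.+1) -> \bar R} :=
  measure_function_pushforward__canonical__measure_function_Measure m
    (@measurable_tcons d).

(* d-dimensional Lebesgue measure, as an iterated product transported along
   R^d x R ~ R^(d+1); R^0 is a point of mass 1. *)
Fixpoint lebesgue_tuple_rec (d : nat) : {measure set (pt R d) -> \bar R} :=
  match d with
  | 0 => \d_([tuple] : pt R 0)
  | d'.+1 => pushforward_tcons (lebesgue_tuple_rec d' \x @lebesgue_measure R)%E
  end.

Definition lebesgue_tuple (d : nat) : set (pt R d) -> \bar R :=
  lebesgue_tuple_rec d.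
Arguments lebesgue_tuple : clear implicits.

HB.instance Definition _ d := Measure.on (lebesgue_tuple d).

Definition box (d : nat) (A : 'I_d -> set (measurableTypeR R)) : set (pt R d) :=
  [set x | forall k, A k (tnth x k)].

Lemma measurable_box d (A : 'I_d -> set (measurableTypeR R)) :
  (forall k, measurable (A k)) -> measurable (box A).
Proof.
move=> mA.
have -> : box A = \bigcap_(k in [set: 'I_d]) ((@tnth d _ ^~ k) @^-1` A k).
  by apply/seteqP; split => x /= h k => [_|]; exact: h.
apply: fin_bigcap_measurable => //.
move=> k _; rewrite -[X in measurable X]setTI.
exact: (measurable_tnth k).
Qed.

Lemma lebesgue_tuple_box d (A : 'I_d -> set (measurableTypeR R)) :
  (forall k, measurable (A k)) ->
  lebesgue_tuple d (box A) = (\prod_(k < d) lebesgue_measure (A k))%E.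
Proof.
rewrite /lebesgue_tuple; elim: d A => [A _|d IHd A mA].
  rewrite big_ord0 /= diracE mem_set//=.
  by case.
rewrite big_ord_recl /= /pushforward.
have -> : tcons (d:=d) @^-1` box A
    = box (fun k => A (lift ord0 k)) `*` A ord0.
  apply/seteqP; split => [[t x]/= h|[t x]/= [ht hx] k].
    split; last exact: (h ord0).
    by move=> k /=; have := h (lift ord0 k); rewrite tnthS.
  case: (unliftP ord0 k) => [j|] -> //.
  by rewrite tnthS; exact: ht.
rewrite product_measure1E //=; last by apply: measurable_box.
by rewrite IHd // muleC.
Qed.

Lemma lebesgue_tuple_sigma_finite d : sigma_finite setT (lebesgue_tuple d).
Proof.
exists (fun m : nat => box (fun _ : 'I_d => `[- m%:R, m%:R]%classic)).
  apply/seteqP; split => // x _.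
  exists (Num.bound (\sum_(k < d) `|tnth x k|)) => //= k.
  rewrite /= in_itv /= -ler_norml.
  apply: le_trans (ltW (archi_boundP _)); last by apply: sumr_ge0.
  by rewrite (bigD1 k)//= lerDl sumr_ge0.
move=> m; split; first by apply: measurable_box => k; exact: measurable_itv.
rewrite lebesgue_tuple_box; last by move=> k; exact: measurable_itv.
rewrite (eq_bigr (fun=> ((m%:R - - m%:R : R))%:E)); first by rewrite prodEFin ltry.
move=> k _; rewrite lebesgue_measure_itv/= lte_fin.
case: ltP => // h; congr EFin.
by apply/eqP; rewrite eq_le; apply/andP; split; rewrite ?subr_ge0 ?subr_le0 //
  -subr_ge0 opprK -natrD.
Qed.

HB.instance Definition _ d := @Measure_isSigmaFinite.Build _ _ _
  (lebesgue_tuple d) (@lebesgue_tuple_sigma_finite d).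

End lebesgue_measure_on_tuples.
Arguments lebesgue_tuple : clear implicits.

Section cramer_von_mises_corners.
Context (R : realType) (d : nat).

Definition cube : set (pt R d) := [set x | forall k, 0 <= tnth x k <= 1].

Definition corner := {ffun 'I_d -> bool}.

Definition cornerLe (c : corner) (x : pt R d) : set (pt R d) :=
  [set s | cube s /\ forall k, if c k then tnth x k <= tnth s k
                               else tnth s k <= tnth x k].

(* The sample X_1, ..., X_n of the usual notation is X 0, ..., X (n-1) here; the
   junk value 0^-1 = 0 for n = 0 plays no role as n --> \oo. *)
Definition empirical_corner (n : nat) (X : 'I_n -> pt R d) (c : corner)
    (x : pt R d) : R :=
  n%:R^-1 * \sum_(i < n) \1_(cornerLe c x) (X i).

Definition uniform_corner (c : corner) (x : pt R d) : R :=
  \prod_(k < d) (if c k then 1 - tnth x k else tnth x k).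

(* The integral is the real-valued one, [fine] of the Lebesgue integral; the
   integrand is bounded and measurable and the cube has finite measure. *)
Definition omega2 (n : nat) (X : 'I_n -> pt R d) : R :=
  (2 ^+ d)^-1 * \sum_(c : corner)
    \int[lebesgue_tuple R d]_(x in cube)
      (empirical_corner X c x - uniform_corner c x) ^+ 2.

Definition orthant_cdf (P : probability (pt R d) R) (x : pt R d) : R :=
  fine (P [set s | cube s /\ forall k, tnth s k <= tnth x k]).

Definition uniform_cdf (x : pt R d) : R := \prod_(k < d) tnth x k.

End cramer_von_mises_corners.
Arguments cube R d : clear implicits.

Section sampling.
Context (dO dT : measure_display) (O : measurableType dO) (T : measurableType dT)
  (R : realType) (Pr : probability O R).

Definition mutually_independent (X : nat -> {RV Pr >-> T}) : Prop :=
  forall (J : {fset nat}) (B : nat -> set T), (forall j, measurable (B j)) ->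
    Pr (\bigcap_(j in [set` J]) (X j @^-1` B j)) =
    (\prod_(j <- J) Pr (X j @^-1` B j))%E.

Definition iid_sample (P : probability T R) (X : nat -> {RV Pr >-> T}) : Prop :=
  mutually_independent X /\
  forall i (A : set T), measurable A -> distribution Pr (X i) A = P A.

Definition cvg_proba_pinfty (Y : nat -> O -> R) : Prop :=
  forall M : R, Pr [set w | M < Y n w] @[n --> \oo] --> 1%E.

End sampling.

(* Main.v *)
Require Import Defs.
From HB Require Import structures.
From mathcomp Require Import all_boot all_order all_algebra.
From mathcomp Require Import finmap.
From mathcomp Require Import all_classical all_reals all_analysis.
From mathcomp Require Import measurable_realfun.
From mathcomp Require Import ring lra.

Set Implicit Arguments.
Unset Strict Implicit.
Unset Printing Implicit Defensive.
Import Order.TTheory GRing.Theory Num.Theory.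
Import numFieldNormedType.Exports.
Local Open Scope classical_set_scope.
Local Open Scope ring_scope.

(* Only the all-[false] corner matters: there F^c is the uniform cdf F_0 and F_n^c
   is the empirical version of F_P. In L^2 of the cube,
   |F_P - F_0|^2 <= 2 (|F_n - F_P|^2 + |F_n - F_0|^2), the left-hand side is a
   constant delta > 0, and E |F_n - F_P|^2 <= 1/n by Tonelli and pairwise
   independence. By Markov's inequality |F_n - F_P|^2 < delta/4 outside an event of
   probability at most 4/(n delta), and then |F_n - F_0|^2 > delta/4, so that
   n omega^2 >= n 2^-d delta/4. *)


(** * Variance of a count of pairwise independent events *)

(** Expanding the square produces only probabilities of pairs, so pairwise independence already
    gives the binomial variance. *)
Lemma integral_centered_indic_sum (R : realType) (dO : measure_display)
    (O : measurableType dO) (Pr : probability O R) (A : nat -> set O) (p : R)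
    (n : nat) (mA : forall i, measurable (A i)) (p0 : 0 <= p)
    (Ap : forall i, Pr (A i) = p%:E)
    (App : forall i j, i != j -> Pr (A i `&` A j) = (p * p)%:E) :
  (\int[Pr]_w ((\sum_(i < n) \1_(A i) w - n%:R * p) ^+ 2)%:E =
   (n%:R * (p * (1 - p)))%:E)%E.
Proof.
pose S (w : O) : R := \sum_(i < n) \1_(A i) w.
have mS : measurable_fun setT S.
  by apply: measurable_sum => i; exact: measurable_indic.
have S0 w : 0 <= S w by apply: sumr_ge0.
pose e := (\int[Pr]_w ((S w - n%:R * p) ^+ 2)%:E)%E.
have np0 : 0 <= n%:R * p by rewrite mulr_ge0.
have intS : (\int[Pr]_w (S w)%:E = (n%:R * p)%:E)%E.
  rewrite /S; under eq_integral do rewrite -sumEFin.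
  rewrite ge0_integral_sum//; last by move=> i; exact/measurable_EFinP/measurable_indic.
  rewrite (eq_bigr (fun=> p%:E)).
    by rewrite sumEFin sumr_const card_ord mulr_natl.
  by move=> i _; rewrite integral_indic// setIT; exact: Ap.
have intS2 : (\int[Pr]_w (S w * S w)%:E = (n%:R * (p * (1 - p)) + (n%:R * p) ^+ 2)%:E)%E.
  under eq_integral => w _.
    rewrite {1}/S mulr_suml -sumEFin.
    under eq_bigr => i _ do rewrite /S mulr_sumr -sumEFin.
    over.
  rewrite ge0_integral_sum//; first last.
  - move=> i w _; apply: sume_ge0 => j _.
    by rewrite lee_fin mulr_ge0.
  - move=> i; apply: emeasurable_sum => j; apply/measurable_EFinP.
    by apply: measurable_funM; exact: measurable_indic.
  rewrite (eq_bigr (fun i : 'I_n => (p * (1 - p) + n%:R * (p * p))%:E)).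
    rewrite sumEFin sumr_const card_ord -[in LHS]mulr_natl; congr EFin; ring.
  move=> i _; rewrite ge0_integral_sum//; last first.
  - move=> j; apply/measurable_EFinP.
    by apply: measurable_funM; exact: measurable_indic.
  (* One formula covers both cases: p = p (1 - p) + p^2 on the diagonal, p^2 off it. *)
  rewrite (eq_bigr (fun j : 'I_n => ((j == i)%:R * (p * (1 - p)) + p * p)%:E)).
    rewrite sumEFin big_split/= sumr_const card_ord -mulr_suml.
    rewrite (bigD1 i)//= eqxx big1 ?addr0 => [|j /negbTE->//].
    by rewrite mul1r mulr_natl.
  move=> j _.
  rewrite (eq_integral (fun w => (\1_(A i `&` A j) w)%:E)); last first.
    by move=> w _; rewrite indicI.
  rewrite integral_indic ?setIT//; last exact: measurableI.
  have [->|ji] := eqVneq j i.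
    by rewrite setIid mul1r [LHS]Ap; congr EFin; ring.
  by rewrite mul0r add0r [LHS]App// eq_sym.
(* Moving the cross term to the left leaves only integrals of nonnegative
   functions. *)
have key : (e + (2 * (n%:R * p) * (n%:R * p))%:E =
    (n%:R * (p * (1 - p)) + (n%:R * p) ^+ 2)%:E + ((n%:R * p) ^+ 2)%:E)%E.
  rewrite -intS2 EFinM -intS -ge0_integralZl//; first last.
  - by rewrite lee_fin mulr_ge0.
  - by move=> w _; rewrite lee_fin.
  - exact/measurable_EFinP.
  rewrite /e -ge0_integralD//; first last.
  - by apply: emeasurable_funM => //; exact/measurable_EFinP.
  - by move=> w _; rewrite mule_ge0// lee_fin// mulr_ge0.
  - by apply/measurable_EFinP/measurable_funX/measurable_funB.
  - by move=> w _; rewrite lee_fin sqr_ge0.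
  rewrite -[X in (_ = _ + X)%E]mule1 -(@probability_setT _ _ _ Pr) -integral_cst//.
  rewrite -ge0_integralD//; first last.
  - by move=> w _; rewrite lee_fin sqr_ge0.
  - by apply/measurable_EFinP/measurable_funM.
  - by move=> w _; rewrite lee_fin mulr_ge0.
  apply: eq_integral => w _; rewrite /cst -EFinM -!EFinD; congr EFin; ring.
(* The finite right-hand side of [key] excludes infinite values of [e], so the cross term can be
   subtracted in the reals. *)
rewrite -/e; move: key; case: e => [r|//|//].
rewrite -!EFinD => -[h]; congr EFin; lra.
Qed.

(** * Measurability and bounds for the corner functions and the statistic *)

Section corner_measurability.
Context (R : realType) (d : nat).

Lemma cubeE : cube R d = box (fun=> `[0, 1]%classic).
Proof.
by apply/seteqP; split => x h k; have := h k; rewrite /= in_itv.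
Qed.

Lemma measurable_cube : measurable (cube R d).
Proof. by rewrite cubeE; apply: measurable_box => k; exact: measurable_itv. Qed.

Lemma lebesgue_cube : lebesgue_tuple R d (cube R d) = 1%E.
Proof.
rewrite cubeE lebesgue_tuple_box; last by move=> k; exact: measurable_itv.
by rewrite big1// => k _; rewrite lebesgue_measure_itv/= lte_fin ltr01 sube0.
Qed.

(** Joint measurability in the vertex and the point is the source of everything below: sections give
    the sets [cornerLe c x], measures of sections give the cdf, and pullbacks give the empirical
    function. *)
Lemma measurable_cornerLe_graph (c : corner d) :
  measurable [set z : pt R d * pt R d | cornerLe c z.1 z.2].
Proof.
pose B k : set (pt R d * pt R d) :=
  [set z | if c k then tnth z.1 k <= tnth z.2 k else tnth z.2 k <= tnth z.1 k].
rewrite (_ : mkset _ = (snd @^-1` cube R d) `&` \bigcap_(k in [set: 'I_d]) B k).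
  apply: measurableI.
    rewrite -[X in measurable X]setTI; apply: measurable_snd => //.
    exact: measurable_cube.
  apply: fin_bigcap_measurable => // k _; rewrite -[X in measurable X]setTI /B.
  have m1 : measurable_fun setT (fun z : pt R d * pt R d => tnth z.1 k).
    exact: (measurableT_comp (measurable_tnth k) measurable_fst).
  have m2 : measurable_fun setT (fun z : pt R d * pt R d => tnth z.2 k).
    exact: (measurableT_comp (measurable_tnth k) measurable_snd).
  by case: (c k); exact: measurable_fun_le.
apply/seteqP; split => z /= [cz h]; split => //; first by move=> k _; exact: h.
by move=> k; exact: (h k I).
Qed.

Lemma measurable_cornerLe (c : corner d) (x : pt R d) : measurable (cornerLe c x).
Proof.
rewrite (_ : cornerLe c x =
    xsection [set z : pt R d * pt R d | cornerLe c z.1 z.2] x).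
  by apply: measurable_xsection; exact: measurable_cornerLe_graph.
by apply/seteqP; split => s; rewrite /xsection /= inE.
Qed.

Lemma measurable_uniform_corner (c : corner d) :
  measurable_fun setT (@uniform_corner R d c).
Proof.
apply: measurable_prod => k _; have mk := @measurable_tnth _ (measurableTypeR R) d k.
by case: (c k) => //; apply: measurable_funB.
Qed.

Lemma uniform_corner_ge0_le1 (c : corner d) (x : pt R d) :
  cube R d x -> 0 <= uniform_corner c x <= 1.
Proof.
move=> cx; have h k : 0 <= (if c k then 1 - tnth x k else tnth x k) <= 1.
  by have := cx k; case: (c k) => /andP[]; lra.
apply/andP; split; first by apply: prodr_ge0 => k _; case/andP: (h k).
by apply: prodr_ile1 => k _; exact: h.
Qed.

Lemma empirical_corner_ge0_le1 n (X : 'I_n -> pt R d) (c : corner d)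
  (x : pt R d) : 0 <= empirical_corner X c x <= 1.
Proof.
rewrite /empirical_corner mulr_ge0 ?invr_ge0 ?sumr_ge0//=.
case: n X => [|n] X; first by rewrite big_ord0 mulr0.
rewrite mulrC ler_pdivrMr ?ltr0n// mul1r.
rewrite -[leRHS](_ : \sum_(i < n.+1) 1 = _); last by rewrite sumr_const card_ord.
by apply: ler_sum => i _; rewrite indicE; case: (_ \in _).
Qed.

Section random_sample.
Context (dO : measure_display) (O : measurableType dO) (n : nat)
  (X : 'I_n -> O -> pt R d) (mX : forall i, measurable_fun setT (X i)).

(** Tonelli requires measurability jointly in the outcome and x. Each indicator is that of the graph
    pulled back along (w, x) -> (x, X_i w). *)
Lemma measurable_empirical_corner (c : corner d) :
  measurable_fun setT
    (fun z : O * pt R d => empirical_corner (X ^~ z.1) c z.2).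
Proof.
apply: measurable_funM => //; apply: measurable_sum => i.
rewrite (_ : (fun _ => _) =
    \1_([set z : pt R d * pt R d | cornerLe c z.1 z.2]) \o
    (fun z : O * pt R d => (z.2, X i z.1))); last first.
  by apply/funext => z /=; rewrite !indicE; congr ((_ : bool)%:R); apply/idP/idP; rewrite !inE.
apply: measurableT_comp.
  apply: measurable_indic; exact: measurable_cornerLe_graph.
apply/measurable_fun_pairP; split; first exact: measurable_snd.
exact: (measurableT_comp (mX i) measurable_fst).
Qed.

(** This is a Tonelli partial integral once the indicator of the cube is moved into the integrand.
    [G] is kept general to serve both for [uniform_corner], in the statistic, and for [corner_cdf],
    in the error term. *)
Lemma measurable_integral_sqrB (c : corner d) (G : pt R d -> R) :
  measurable_fun setT G ->
  measurable_fun setT (fun w => \int[lebesgue_tuple R d]_(x in cube R d)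
    ((empirical_corner (X ^~ w) c x - G x) ^+ 2)%:E)%E.
Proof.
move=> mG; pose f (z : O * pt R d) : \bar R :=
  (((empirical_corner (X ^~ z.1) c z.2 - G z.2) ^+ 2)%:E * (\1_(cube R d) z.2)%:E)%E.
rewrite (_ : (fun _ => _) = fubini_F (lebesgue_tuple R d) f); last first.
  by apply/funext => w; rewrite /fubini_F [LHS]integral_mkcond epatch_indic.
apply: measurable_fun_fubini_tonelli_F; last first.
  by move=> z; rewrite mule_ge0// lee_fin ?sqr_ge0.
apply: emeasurable_funM; apply/measurable_EFinP.
  apply: measurable_funX; apply: measurable_funB.
    exact: measurable_empirical_corner.
  exact: (measurableT_comp mG measurable_snd).
apply: measurableT_comp; first by apply: measurable_indic; exact: measurable_cube.
exact: measurable_snd.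
Qed.

Lemma measurable_omega2 : measurable_fun setT (fun w => omega2 (X ^~ w)).
Proof.
apply: measurable_funM => //; apply: measurable_sum => c.
rewrite /Rintegral; apply: (measurableT_comp (@fine_measurable _ setT measurableT)).
by apply: measurable_integral_sqrB; exact: measurable_uniform_corner.
Qed.

End random_sample.

End corner_measurability.

(** * Mean square error of the empirical corner functions *)

Section corner_cdf.
Context (R : realType) (d : nat) (P : probability (pt R d) R).

Definition corner_cdf (c : corner d) (x : pt R d) : R := fine (P (cornerLe c x)).

Lemma corner_cdfE (c : corner d) (x : pt R d) :
  P (cornerLe c x) = (corner_cdf c x)%:E.
Proof. by rewrite fineK// fin_num_measure//; exact: measurable_cornerLe. Qed.

Lemma measurable_corner_cdf (c : corner d) : measurable_fun setT (corner_cdf c).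
Proof.
apply: (measurableT_comp (@fine_measurable _ setT measurableT)).
rewrite (_ : (fun _ => _) =
    P \o xsection [set z : pt R d * pt R d | cornerLe c z.1 z.2]).
  apply: measurable_fun_xsection; exact: measurable_cornerLe_graph.
apply/funext => x /=; congr (P _).
by apply/seteqP; split => s; rewrite /xsection /= inE.
Qed.

Lemma corner_cdf_ge0_le1 (c : corner d) (x : pt R d) : 0 <= corner_cdf c x <= 1.
Proof.
rewrite -!lee_fin -corner_cdfE measure_ge0/=; apply: probability_le1.
exact: measurable_cornerLe.
Qed.

Lemma orthant_corner_cdf (x : pt R d) :
  orthant_cdf P x = corner_cdf [ffun=> false] x.
Proof.
congr (fine (P _)); apply/seteqP.
by split => s /= [cs h]; split => // k; have := h k; rewrite ffunE.
Qed.

Lemma uniform_cdf_corner (x : pt R d) :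
  uniform_cdf x = uniform_corner [ffun=> false] x.
Proof. by apply: eq_bigr => k _; rewrite ffunE. Qed.

Context (dO : measure_display) (O : measurableType dO) (Pr : probability O R)
  (X : nat -> {RV Pr >-> pt R d}) (hX : iid_sample P X).

Lemma iid_sample_law i (B : set (pt R d)) :
  measurable B -> Pr (X i @^-1` B) = P B.
Proof. by move=> mB; rewrite -(hX.2 i B mB). Qed.

(** Mutual independence specialised to the index set {i, j}, the form that the variance computation
    uses. *)
Lemma iid_sample_pair i j (B : set (pt R d)) : measurable B -> i != j ->
  Pr (X i @^-1` B `&` X j @^-1` B) = (P B * P B)%E.
Proof.
move=> mB ij; have := hX.1 [fset i; j]%fset (fun=> B) (fun=> mB).
rewrite big_fsetU1/=; last by rewrite inE.
rewrite big_seq_fset1 !iid_sample_law// => <-; congr (Pr _).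
apply/seteqP; split => w /=.
  by move=> [wi wj] k /=; rewrite !inE => /orP[] /eqP->.
by move=> h; split; apply: h; rewrite /= !inE eqxx ?orbT.
Qed.

(** The variance n p (1 - p) of the count, divided by n^2, is at most 1/n because p lies in [0, 1].
    The bound is uniform in x, so it can be integrated over the cube. *)
Lemma expected_sqr_empirical_corner (c : corner d) (x : pt R d) n :
  (0 < n)%N ->
  (\int[Pr]_w ((empirical_corner (fun i : 'I_n => X i w) c x
     - corner_cdf c x) ^+ 2)%:E <= (n%:R^-1)%:E)%E.
Proof.
move=> n0; have n0' : (n%:R : R) != 0 by rewrite pnatr_eq0 -lt0n.
set p := corner_cdf c x; have /andP[p0 p1] := corner_cdf_ge0_le1 c x.
have mC := measurable_cornerLe c x.
pose A i := X i @^-1` cornerLe c x.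
have mA i : measurable (A i).
  by rewrite -[A i]setTI; exact: (measurable_funPT (X i)).
rewrite (eq_integral (fun w => ((n%:R ^- 2)%:E *
    ((\sum_(i < n) \1_(A i) w - n%:R * p) ^+ 2)%:E)%E)); last first.
  move=> w _; rewrite -EFinM; congr EFin.
  rewrite -exprVn -exprMn; congr (_ ^+ 2).
  by rewrite mulrBr mulrA mulVf// mul1r.
rewrite ge0_integralZl//; first last.
- by move=> w _; rewrite lee_fin sqr_ge0.
- apply/measurable_EFinP/measurable_funX/measurable_funB => //.
  by apply: measurable_sum => i; exact: measurable_indic.
rewrite (integral_centered_indic_sum n mA p0); first last.
- by move=> i j ij; rewrite iid_sample_pair// corner_cdfE.
- by move=> i; rewrite iid_sample_law// corner_cdfE.
rewrite -EFinM lee_fin expr2 invfM -mulrA mulKf// ler_piMr ?invr_ge0//.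
by nra.
Qed.

Lemma expected_L2_empirical_corner (c : corner d) n : (0 < n)%N ->
  (\int[Pr]_w \int[lebesgue_tuple R d]_(x in cube R d)
     ((empirical_corner (fun i : 'I_n => X i w) c x - corner_cdf c x) ^+ 2)%:E
   <= (n%:R^-1)%:E)%E.
Proof.
move=> n0; have mX (i : 'I_n) : measurable_fun setT (X i) by exact: measurable_funPT.
pose f (z : O * pt R d) : \bar R :=
  (((empirical_corner (fun i : 'I_n => X i z.1) c z.2 - corner_cdf c z.2) ^+ 2)%:E
   * (\1_(cube R d) z.2)%:E)%E.
have f0 z : (0 <= f z)%E by rewrite mule_ge0// lee_fin ?sqr_ge0.
have mf : measurable_fun setT f.
  apply: emeasurable_funM; apply/measurable_EFinP.
    apply: measurable_funX; apply: measurable_funB.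
      exact: (measurable_empirical_corner mX).
    exact: (measurableT_comp (measurable_corner_cdf c) measurable_snd).
  apply: measurableT_comp; first by apply: measurable_indic; exact: measurable_cube.
  exact: measurable_snd.
rewrite (eq_integral (fun w => \int[lebesgue_tuple R d]_x f (w, x))%E); last first.
  by move=> w _; rewrite [LHS]integral_mkcond epatch_indic.
rewrite (@fubini_tonelli _ _ _ _ _ Pr (lebesgue_tuple R d) f mf f0).
(* The cube has unit volume, so 1/n is its own integral over it, and the comparison reduces to the
   bound at each x. *)
rewrite -[leRHS]mule1 -(lebesgue_cube R d) -integral_cst; last exact: measurable_cube.
rewrite [leRHS]integral_mkcond epatch_indic.
apply: ge0_le_integral => //.
- by move=> x _; exact: integral_ge0.
- exact: measurable_fun_fubini_tonelli_G.
- apply: emeasurable_funM => //; apply/measurable_EFinP.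
  apply: measurable_indic; exact: measurable_cube.
move=> x _; rewrite /f /=.
rewrite indicE; case: (_ \in _); last first.
  by under eq_integral do rewrite mule0; rewrite integral0 mule0.
rewrite mule1; under eq_integral do rewrite mule1.
exact: expected_sqr_empirical_corner.
Qed.

End corner_cdf.

(** * Squared L^2 distance on the cube *)

Section L2_distance_on_cube.
Context (R : realType) (d : nat).

(** The distance is squared, with no root taken. Extended real values suit Tonelli and Markov, and
    for the empirical and uniform functions of a corner its [fine] is the summand of [omega2]. *)
Definition cube_L2 (f g : pt R d -> R) : \bar R :=
  (\int[lebesgue_tuple R d]_(x in cube R d) ((f x - g x) ^+ 2)%:E)%E.

Lemma cube_L2_ge0 (f g : pt R d -> R) : (0 <= cube_L2 f g)%E.
Proof. by apply: integral_ge0 => x _; rewrite lee_fin sqr_ge0. Qed.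

Let measurable_sqrB (f g : pt R d -> R) : measurable_fun setT f ->
  measurable_fun setT g ->
  measurable_fun (cube R d) (fun x => ((f x - g x) ^+ 2)%:E).
Proof.
move=> mf mg; apply: measurable_funTS; apply/measurable_EFinP.
by apply: measurable_funX; exact: measurable_funB.
Qed.

Lemma cube_L2_fin_num (f g : pt R d -> R) :
  measurable_fun setT f -> measurable_fun setT g ->
  (forall x, cube R d x -> 0 <= f x <= 1) ->
  (forall x, cube R d x -> 0 <= g x <= 1) -> cube_L2 f g \is a fin_num.
Proof.
move=> mf mg f01 g01; rewrite ge0_fin_numE ?cube_L2_ge0//.
apply: (@le_lt_trans _ _ 1%E); last exact: ltry.
rewrite -[leRHS]mul1e -[X in (_ * X)%E](lebesgue_cube R d) -integral_cst;
  last exact: measurable_cube.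
apply: ge0_le_integral => //.
- exact: measurable_cube.
- by move=> x _; rewrite lee_fin sqr_ge0.
- exact: measurable_sqrB.
move=> x cx; rewrite lee_fin.
by have /andP[? ?] := f01 _ cx; have /andP[? ?] := g01 _ cx; nra.
Qed.

Lemma cube_L2_triangle (f g h : pt R d -> R) :
  measurable_fun setT f -> measurable_fun setT g -> measurable_fun setT h ->
  (cube_L2 g h <= 2%:E * (cube_L2 f g + cube_L2 f h))%E.
Proof.
move=> mf mg mh; have mC := @measurable_cube R d.
rewrite /cube_L2 -ge0_integralD//; [|by move=> x _; rewrite lee_fin sqr_ge0
  |exact: measurable_sqrB|by move=> x _; rewrite lee_fin sqr_ge0
  |exact: measurable_sqrB].
rewrite -ge0_integralZl//; [|by apply: emeasurable_funD; exact: measurable_sqrB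
  |by move=> x _; rewrite -EFinD lee_fin addr_ge0// sqr_ge0].
apply: ge0_le_integral => //.
- by move=> x _; rewrite lee_fin sqr_ge0.
- exact: measurable_sqrB.
- apply: emeasurable_funM => //.
  by apply: emeasurable_funD; exact: measurable_sqrB.
move=> x _; rewrite -EFinD -EFinM lee_fin.
(* With a = f - g and b = f - h, this is 2 a^2 + 2 b^2 - (a - b)^2 = (a + b)^2 >= 0. *)
have := sqr_ge0 ((f x - g x) + (f x - h x)); nra.
Qed.

(** A zero integral of a nonnegative function forces it to vanish almost everywhere on the cube,
    which would put [A] inside a null set. *)
Lemma cube_L2_gt0 (f g : pt R d -> R) (A : set (pt R d)) :
  measurable_fun setT f -> measurable_fun setT g ->
  measurable A -> A `<=` cube R d -> (0 < lebesgue_tuple R d A)%E ->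
  (forall x, A x -> f x <> g x) -> (0 < cube_L2 f g)%E.
Proof.
move=> mf mg mA Acube A0 Afg; have mC := @measurable_cube R d.
rewrite lt0e cube_L2_ge0 andbT; apply/eqP => L0.
have /(ae_eq_integral_abs _ mC (measurable_sqrB mf mg)) :
    (\int[lebesgue_tuple R d]_(x in cube R d)
    `|((f x - g x) ^+ 2)%:E|)%E = 0.
  rewrite -[RHS]L0; apply: eq_integral => x _.
  by rewrite gee0_abs// lee_fin sqr_ge0.
move=> [N [mN N0 subN]]; move: A0.
rewrite (_ : lebesgue_tuple R d A = 0%E) ?ltxx//.
apply: (subset_measure0 mA mN _ N0) => x Ax; apply: subN => /= /(_ (Acube _ Ax)) [].
move/eqP; rewrite sqrf_eq0 subr_eq0 => /eqP; exact: Afg.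
Qed.

End L2_distance_on_cube.

(** * Divergence of the statistic from a single corner *)

Lemma omega2_ge_corner (R : realType) (d n : nat) (X : 'I_n -> pt R d) (c : corner d) :
  (2 ^+ d)^-1 * fine (cube_L2 (empirical_corner X c) (uniform_corner c)) <= omega2 X.
Proof.
rewrite /omega2 ler_wpM2l ?invr_ge0 ?exprn_ge0//.
rewrite (bigD1 c)//= lerDl sumr_ge0// => c' _.
by apply: Rintegral_ge0 => x _; rewrite sqr_ge0.
Qed.

Lemma cvg_1B_divn (R : realType) (K : R) :
  (1 - K * n%:R^-1)%:E @[n --> \oo] --> 1%E.
Proof.
apply: cvg_EFin; first exact: nearW.
rewrite -[X in _ --> X](_ : 1 - K * 0 = 1); last by rewrite mulr0 subr0.
apply: cvgB; first exact: cvg_cst.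
apply: cvgM; first exact: cvg_cst.
apply/gtr0_cvgV0; last exact: cvgr_idn.
by exists 1%N => // n /= n1; rewrite ltr0n.
Qed.

Theorem proposition3p18 (R : realType) (d : nat) (hd : (0 < d)%N)
    (P : probability (pt R d) R) (hP : P (cube R d) = 1%E)
    (hne : exists2 A : set (pt R d),
        measurable A /\ A `<=` cube R d &
        (0 < lebesgue_tuple R d A)%E /\
        forall x, A x -> orthant_cdf P x <> uniform_cdf x)
    (dO : measure_display) (O : measurableType dO) (Pr : probability O R)
    (X : nat -> {RV Pr >-> pt R d}) (hX : iid_sample P X) :
  cvg_proba_pinfty Pr
    (fun n w => n%:R * omega2 (fun i : 'I_n => X i w)).
Proof.
move: hne => [A [mA Acube] [A0 Ane]] M.
pose c : corner d := [ffun=> false].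
have mX n (i : 'I_n) : measurable_fun setT (X i) by exact: measurable_funPT.
have mF := measurable_corner_cdf P c.
have mU := @measurable_uniform_corner R d c.
have mE n w : measurable_fun setT (empirical_corner (fun i : 'I_n => X i w) c).
  exact: (measurableT_comp (measurable_empirical_corner (@mX n) c)
    (measurable_pair1 w)).
have F01 x : cube R d x -> 0 <= corner_cdf P c x <= 1.
  by move=> _; exact: corner_cdf_ge0_le1.
have U01 := @uniform_corner_ge0_le1 R d c.
have E01 n w x : cube R d x ->
    0 <= empirical_corner (fun i : 'I_n => X i w) c x <= 1.
  by move=> _; exact: empirical_corner_ge0_le1.
have : (0 < cube_L2 (corner_cdf P c) (uniform_corner c))%E.
  apply: (cube_L2_gt0 mF mU mA Acube A0) => x Ax.
  by rewrite -orthant_corner_cdf -uniform_cdf_corner; exact: Ane.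
rewrite -(fineK (cube_L2_fin_num mF mU F01 U01)).
set delta := fine _ => delta0; rewrite lte_fin in delta0.
pose G n w := cube_L2 (empirical_corner (fun i : 'I_n => X i w) c) (corner_cdf P c).
have mG n : measurable_fun setT (G n).
  exact: (measurable_integral_sqrB (@mX n)).
have mY n : measurable_fun setT (fun w => n%:R * omega2 (fun i : 'I_n => X i w)).
  by apply: measurable_funM => //; exact: (measurable_omega2 (@mX n)).
have mS n : measurable [set w | M < n%:R * omega2 (fun i : 'I_n => X i w)].
  rewrite (_ : mkset _ = (fun w => n%:R * omega2 (fun i : 'I_n => X i w)) @^-1`
      `]M, +oo[%classic).
    by rewrite -[X in measurable X]setTI; apply: mY => //; exact: measurable_itv.
  by apply/seteqP; split => w; rewrite /= in_itv/= andbT.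
have tail n : (0 < n)%N ->
    (Pr [set w | (delta / 4)%:E <= G n w] <= (4 / delta * n%:R^-1)%:E)%E.
  move=> n0; have d4 : 0 < delta / 4 by rewrite divr_gt0.
  (* Markov's inequality, with the identity as the monotone function. It concerns the absolute value
     of [G n], which is dropped below since [G n] is nonnegative. *)
  have := @le_integral_comp_abse _ _ _ Pr setT measurableT (G n) (delta / 4) id
    (@measurable_id _ _ _) (fun _ h => h) (fun _ _ _ _ h => h) (mG n) d4.
  rewrite setTI /= => mk.
  rewrite -(@lee_pmul2l _ (delta / 4)%:E)// -EFinM.
  have -> : delta / 4 * (4 / delta * n%:R^-1) = n%:R^-1.
    by rewrite mulrA -[RHS]mul1r; congr (_ * _); field; rewrite gt_eqF.
  apply: le_trans (expected_L2_empirical_corner hX c n0).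
  move: mk; rewrite (eq_integral (G n)) => [|w _]; last by rewrite gee0_abs// cube_L2_ge0.
  rewrite (_ : [set w | _] = [set w | (delta / 4)%:E <= G n w]%E)//.
  by apply/seteqP; split => w /=; rewrite gee0_abs// cube_L2_ge0.
apply: (@squeeze_cvge _ _ _ _ (fun n => (1 - 4 / delta * n%:R^-1)%:E) _ (cst 1%E)).
- near=> n.
  have n0 : (0 < n)%N by near: n; exact: nbhs_infty_gt.
  (* This threshold makes n 2^-d delta/4 exceed M. *)
  have nM : M * 2 ^+ d * 4 / delta < n%:R by near: n; exact: nbhs_infty_gtr.
  rewrite probability_le1// andbT.
  set S := [set w | M < _].
  have mSC : measurable (~` S) by apply: measurableC; exact: mS.
  (* It suffices to bound the probability of the complement of [S], by including it in the Markov
     event. *)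
  rewrite -[S]setCK probability_setC//.
  rewrite EFinB leeD2l// leeN2; apply: le_trans (tail n n0).
  apply: le_measure; rewrite ?inE.
  + exact: mSC.
  + by rewrite -[X in measurable X]setTI; exact: measurable_lee.
  (* Suppose [G n w] is below delta/4 at an outcome outside [S]. Then delta <= 2 (G + H) gives H >
     delta/4, hence n omega^2 >= n 2^-d H > M, a contradiction. Finiteness of all three distances
     lets this be done in real arithmetic. *)
  move=> w /= /negP; rewrite -leNgt => wS; rewrite leNgt; apply/negP => Gw.
  have Efin := cube_L2_fin_num (mE n w) mU (@E01 n w) U01.
  have Gfin : G n w \is a fin_num := cube_L2_fin_num (mE n w) mF (@E01 n w) F01.
  have := cube_L2_triangle (mE n w) mF mU.
  rewrite -/(G n w) -(fineK (cube_L2_fin_num mF mU F01 U01)) -/delta.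
  move: Gw; rewrite -(fineK Efin) -(fineK Gfin) -EFinD -EFinM lte_fin lee_fin.
  move=> Gw tri; move: wS; apply/negP; rewrite -ltNge.
  pose H := fine (cube_L2 (empirical_corner (fun i : 'I_n => X i w) c)
    (uniform_corner c)).
  have {}tri : delta <= 2 * (fine (G n w) + H) := tri.
  have Hd : delta / 4 < H by lra.
  apply: lt_le_trans (ler_wpM2l (ler0n _ _) (omega2_ge_corner _ c)).
  have e0 : 0 < (2 ^+ d : R) by rewrite exprn_gt0.
  rewrite -/H mulrCA ltr_pdivlMl//.
  have : n%:R * (delta / 4) < n%:R * H by rewrite ltr_pM2l// ltr0n.
  by move: nM; rewrite ltr_pdivrMr//; lra.
- exact: cvg_1B_divn.
- exact: cvg_cst.
Unshelve. all: by end_near.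
Qed.
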